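(* Let $\tau=m/2$. Every instance with $3$ agents and $m\ge 3$ projects admits a budget-feasible solution which satisfies all three agents, and such a solution can be computed in polynomial time.
   Context: An instance with $n$ agents and $m$ projects consists of demands $d^i_j\in[0,1]$ for $i\in[n]=\{1,\dots,n\}$ and $j\in[m]$, with $\sum_{j=1}^m d^i_j\le 1$ for every agent $i$ (for computational statements, demands are rational numbers given explicitly). A solution is a vector $\mathbf{x}\in[0,1]^m$; it is budget-feasible if $\sum_{j=1}^m x_j\le 1$. Given a threshold $\tau$ (not necessarily an integer), agent $i$ is satisfied by $\mathbf{x}$ if the number of projects $j\in[m]$ with $x_j\ge d^i_j$ is at least $\tau$. *)

(* Defs.v *)
From HB Require Import structures.
From mathcomp Require Import all_boot all_order all_algebra.
From mathcomp Require Import reals.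

Set Implicit Arguments.
Unset Strict Implicit.
Unset Printing Implicit Defensive.

Import Order.TTheory GRing.Theory Num.Theory.
Local Open Scope ring_scope.

(* An instance is the matrix of demands (rows: agents, columns: projects),
   a solution is a row vector. *)

Definition is_instance (R : numDomainType) (n m : nat) (d : 'M[R]_(n, m)) :
    Prop :=
  (forall i j, 0 <= d i j <= 1) /\ (forall i, \sum_(j < m) d i j <= 1).

Definition is_solution (R : numDomainType) (m : nat) (x : 'rV[R]_m) : Prop :=
  forall j, 0 <= x 0 j <= 1.

Definition budget_feasible (R : numDomainType) (m : nat) (x : 'rV[R]_m) :
    Prop :=
  \sum_(j < m) x 0 j <= 1.

Definition satisfied (R : numDomainType) (n m : nat) (tau : R)
    (d : 'M[R]_(n, m)) (x : 'rV[R]_m) (i : 'I_n) : Prop :=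
  tau <= #|[set j : 'I_m | d i j <= x 0 j]|%:R.

(* Polynomial time is measured on a random access machine with logarithmic
   (bit) cost and structured control flow.  Its memory consists of arrays
   of natural numbers: [s a k] is cell [k] of array [a].  Array names are
   constants of the program text, so a program uses finitely many arrays;
   indices are computed. *)

Definition store := nat -> nat -> nat.

Definition update (s : store) (a k v : nat) : store :=
  fun b l => if (b == a) && (l == k) then v else s b l.

(* Subtraction is truncated; division is Euclidean, with [v %/ 0 = 0]. *)
Inductive binop := OpAdd | OpSub | OpMul | OpDiv.

Definition apply_op (o : binop) (u v : nat) : nat :=
  match o with
  | OpAdd => u + v
  | OpSub => u - v
  | OpMul => u * v
  | OpDiv => u %/ v
  end%N.

Inductive expr :=
  | EConst of nat
  | EGet of nat & expr
  | EOp of binop & expr & expr.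

Inductive cmd :=
  | CSkip
  | CSet of nat & expr & expr
  | CSeq of cmd & cmd
  | CIf of expr & cmd & cmd
  | CWhile of expr & cmd.

Fixpoint eval (s : store) (e : expr) : nat :=
  match e with
  | EConst v => v
  | EGet a e1 => s a (eval s e1)
  | EOp o e1 e2 => apply_op o (eval s e1) (eval s e2)
  end.

(* Length of the binary expansion, with [bitlen 0 = 1]. *)
Definition bitlen (v : nat) : nat := (trunc_log 2 v).+1.

(* Every operation is charged the bit length of all the numbers it reads
   (addresses included) and of the number it produces. *)
Fixpoint ecost (s : store) (e : expr) : nat :=
  match e with
  | EConst v => bitlen v
  | EGet a e1 => ecost s e1 + bitlen (eval s e1) + bitlen (eval s e)
  | EOp o e1 e2 =>
      ecost s e1 + ecost s e2
      + bitlen (eval s e1) + bitlen (eval s e2) + bitlen (eval s e)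
  end%N.

(* [exec c s t s']: started in [s], the program [c] halts in [s'] at total
   cost [t].  Nonzero numbers count as true. *)
Inductive exec : cmd -> store -> nat -> store -> Prop :=
  | ExecSkip s : exec CSkip s 1 s
  | ExecSet s a e1 e2 :
      exec (CSet a e1 e2) s
        (ecost s e1 + ecost s e2 + bitlen (eval s e1) + bitlen (eval s e2))%N
        (update s a (eval s e1) (eval s e2))
  | ExecSeq c1 c2 s t1 s1 t2 s2 :
      exec c1 s t1 s1 -> exec c2 s1 t2 s2 ->
      exec (CSeq c1 c2) s (t1 + t2)%N s2
  | ExecIfTrue e c1 c2 s t s1 :
      eval s e != 0%N -> exec c1 s t s1 ->
      exec (CIf e c1 c2) s (ecost s e + t)%N s1
  | ExecIfFalse e c1 c2 s t s1 :
      eval s e = 0%N -> exec c2 s t s1 ->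
      exec (CIf e c1 c2) s (ecost s e + t)%N s1
  | ExecWhileTrue e c s t1 s1 t2 s2 :
      eval s e != 0%N -> exec c s t1 s1 -> exec (CWhile e c) s1 t2 s2 ->
      exec (CWhile e c) s (ecost s e + t1 + t2)%N s2
  | ExecWhileFalse e c s :
      eval s e = 0%N -> exec (CWhile e c) s (ecost s e) s.

(* A rational instance is given by [n] and [m] (array 0) and by the
   numerators (array 1) and denominators (array 2) of its demands in lowest
   terms, in row-major order; demands are nonnegative, so the absolute value
   of the numerator loses nothing. *)
Definition input (n m : nat) (d : 'M[rat]_(n, m)) : seq (seq nat) :=
  [:: [:: n; m];
      [seq `|numq (d i j)|%N | i <- enum 'I_n, j <- enum 'I_m];
      [seq `|denq (d i j)|%N | i <- enum 'I_n, j <- enum 'I_m]].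

Definition input_size (n m : nat) (d : 'M[rat]_(n, m)) : nat :=
  (\sum_(l <- input d) \sum_(v <- l) bitlen v)%N.

(* All the cells which do not hold the input are initially 0. *)
Definition load (n m : nat) (d : 'M[rat]_(n, m)) : store :=
  fun a k => nth 0%N (nth [::] (input d) a) k.

(* On halting, arrays 3 and 4 hold numerators and denominators of the
   solution, as fractions which need not be in lowest terms. *)
Definition outputs (m : nat) (s : store) (x : 'rV[rat]_m) : Prop :=
  forall j : 'I_m, s 4%N j != 0%N /\ x 0 j = (s 3%N j)%:R / (s 4%N j)%:R.

(* A single program which, on every instance [d] with [n] agents satisfying
   [pre], halts within time polynomial in the size of [d] and outputs some
   [x] such that [post d x]. *)
Definition poly_time_computable (n : nat)
    (pre : forall m, 'M[rat]_(n, m) -> Prop)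
    (post : forall m, 'M[rat]_(n, m) -> 'rV[rat]_m -> Prop) : Prop :=
  exists (c : cmd) (a k : nat),
  forall (m : nat) (d : 'M[rat]_(n, m)), pre m d ->
  exists (t : nat) (s : store) (x : 'rV[rat]_m),
    [/\ exec c (load d) t s,
        (t <= a * input_size d ^ k + a)%N,
        outputs s x
      & post m d x].

(* Main.v *)
(* The proof goes through majority comparisons.  Say that agent [i] beats
   agent [l] if [d^l_j <= d^i_j] for at least half of the projects; any two
   agents are comparable.  If some agent beats the two others, then its demand
   vector satisfies everybody.  Otherwise the agents form a cycle: [p] beats
   [q], [q] beats [r] and [r] beats [p].  Let [x^p_j] be [max (d^q_j, d^r_j)]
   if [d^q_j <= d^p_j], and [d^p_j] otherwise.  The projects on which [p] is at
   least [q] satisfy [q] and [r], and those on which [r] is at least [p]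
   satisfy [p].  The three vectors obtained by rotating the cycle satisfy
   [x^p + x^q + x^r <= d^p + d^q + d^r] coordinatewise, so one of them costs at
   most 1.  The algorithm tests the vectors given by all triples of agents. *)

Require Import Defs.
From mathcomp Require Import all_boot all_order all_algebra.
From mathcomp Require Import reals.
From mathcomp Require Import zify lra ring.

Set Implicit Arguments.
Unset Strict Implicit.
Unset Printing Implicit Defensive.

Import Order.TTheory GRing.Theory Num.Theory.
Local Open Scope nat_scope.

(** * Cost of straight-line programs and of loops *)

Definition bounded (W : nat) (s : store) : Prop := forall a k, s a k <= 2 ^ W.

Lemma boundedW W V s : W <= V -> bounded W s -> bounded V s.
Proof. by move=> le_WV bs a k; apply: leq_trans (bs a k) _; rewrite leq_exp2l. Qed.

Lemma bitlen_le v W : v <= 2 ^ W -> bitlen v <= W.+1.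
Proof.
move=> le_v; rewrite /bitlen ltnS; case: v le_v => [|v] le_v.
  by rewrite trunc_log0.
by rewrite -(trunc_expnK W (ltnSn 1)) leq_trunc_log.
Qed.

(** Bit lengths at worst add up. Positive exponents matter for sums: two powers that are at least 2
    have a sum bounded by their product. *)
Lemma apply_op_le o u v W V : 0 < W -> 0 < V -> u <= 2 ^ W -> v <= 2 ^ V ->
  apply_op o u v <= 2 ^ (W + V).
Proof.
move=> W0 V0 le_u le_v.
have le_uW : u <= 2 ^ (W + V).
  by apply: leq_trans le_u _; rewrite leq_exp2l // leq_addr.
case: o => /=.
- apply: leq_trans (leq_add le_u le_v) _; rewrite expnD.
  have : 2 <= 2 ^ W by rewrite -{1}(expn1 2) leq_exp2l.
  have : 2 <= 2 ^ V by rewrite -{1}(expn1 2) leq_exp2l.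
  nia.
- exact: leq_trans (leq_subr _ _) le_uW.
- by rewrite expnD leq_mul.
exact: leq_trans (leq_div _ _) le_uW.
Qed.

(** A fixed expression combines boundedly many numbers, so values and costs stay linear in [W].
    Taking [W] positive lets [K * W] absorb constants as well. *)
Lemma eval_cost e : exists2 K, 0 < K &
  forall s W, 0 < W -> bounded W s ->
    eval s e <= 2 ^ (K * W) /\ ecost s e <= K * W.
Proof.
elim: e => [v|a e [K K0 He]|o e1 [K1 K10 He1] e2 [K2 K20 He2]].
- exists v.+1 => // s W W0 bs; have le_v: v <= 2 ^ v by rewrite ltnW // ltn_expl.
  have le_vW : v.+1 <= v.+1 * W by rewrite leq_pmulr.
  split=> /=; last exact: leq_trans (bitlen_le le_v) _.
  by apply: leq_trans le_v _; rewrite leq_exp2l // ltnW.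
- exists (2 * K + 4) => [|s W W0 bs]; first by rewrite addnS.
  have [le_e cost_e] := He s W W0 bs; split=> /=.
    by apply: leq_trans (bs _ _) _; rewrite leq_exp2l // leq_pmull // addnS.
  have := bitlen_le le_e; have := bitlen_le (bs a (eval s e)); nia.
exists (3 * (K1 + K2) + 3) => [|s W W0 bs]; first by rewrite addnS.
have [le_e1 cost_e1] := He1 s W W0 bs; have [le_e2 cost_e2] := He2 s W W0 bs.
have := @apply_op_le o _ _ (K1 * W) (K2 * W) _ _ le_e1 le_e2.
rewrite !muln_gt0 K10 K20 W0 -mulnDl => /(_ isT isT) le_e.
split=> /=; first by apply: leq_trans le_e _; rewrite leq_exp2l //; nia.
have := bitlen_le le_e1; have := bitlen_le le_e2; have := bitlen_le le_e; nia.
Qed.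

Fixpoint loopfree (c : cmd) : bool :=
  match c with
  | CSkip | CSet _ _ _ => true
  | CSeq c1 c2 | CIf _ c1 c2 => loopfree c1 && loopfree c2
  | CWhile _ _ => false
  end.

(* Junk on loops: only meant for loop-free programs. *)
Fixpoint sem (c : cmd) (s : store) : store :=
  match c with
  | CSet a e1 e2 => update s a (eval s e1) (eval s e2)
  | CSeq c1 c2 => sem c2 (sem c1 s)
  | CIf e c1 c2 => if eval s e != 0 then sem c1 s else sem c2 s
  | CSkip | CWhile _ _ => s
  end.

(* [K] depends on the program only, so that the bound composes with itself a
   constant number of times but must not be iterated over a loop. *)
Lemma loopfree_exec c : loopfree c -> exists2 K, 0 < K &
  forall s W, 0 < W -> bounded W s ->
    exists t, [/\ exec c s t (sem c s), t <= K * W & bounded (K * W) (sem c s)].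
Proof.
elim: c => [|a e1 e2|c1 IH1 c2 IH2|e c1 IH1 c2 IH2|//] /=.
- move=> _; exists 1 => // s W W0 bs; exists 1; rewrite mul1n.
  by split=> //; constructor.
- move=> _; have [K1 K10 H1] := eval_cost e1; have [K2 K20 H2] := eval_cost e2.
  exists (2 * (K1 + K2) + 2) => [|s W W0 bs]; first by rewrite addnS.
  have [le1 cost1] := H1 s W W0 bs; have [le2 cost2] := H2 s W W0 bs.
  eexists; split; first by constructor.
    by have := bitlen_le le1; have := bitlen_le le2; nia.
  move=> b l; rewrite /update; case: ifP => _.
    by apply: leq_trans le2 _; rewrite leq_exp2l //; nia.
  by apply: leq_trans (bs b l) _; rewrite leq_exp2l //; nia.
- case/andP=> /IH1[K1 K10 H1] /IH2[K2 K20 H2].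
  (* The second command starts on numbers of [K1 * W] bits, hence the product of the constants. *)
  exists (K1 + K2 * K1) => [|s W W0 bs]; first by rewrite addn_gt0 K10.
  have [t1 [ex1 le1 b1]] := H1 s W W0 bs.
  have KW0 : 0 < K1 * W by rewrite muln_gt0 K10.
  have [t2 [ex2 le2 b2]] := H2 _ _ KW0 b1.
  exists (t1 + t2); split; first exact: ExecSeq ex1 ex2.
    by rewrite mulnDl -mulnA leq_add.
  by apply: boundedW b2; rewrite mulnA leq_mul2r leq_addl orbT.
case/andP=> /IH1[K1 K10 H1] /IH2[K2 K20 H2].
have [K K0 He] := eval_cost e.
exists (K + (K1 + K2)) => [|s W W0 bs]; first by rewrite addn_gt0 K0.
have [_ cost_e] := He s W W0 bs.
have [t1 [ex1 le1 b1]] := H1 s W W0 bs; have [t2 [ex2 le2 b2]] := H2 s W W0 bs.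
case: eqP => [e0|/eqP e0]; [exists (ecost s e + t2) | exists (ecost s e + t1)].
  split; [exact: ExecIfFalse | nia | by apply: boundedW b2; nia].
by split; [exact: ExecIfTrue | nia | by apply: boundedW b1; nia].
Qed.

(** The invariant re-establishes the same bound [W] before each iteration. Every round then costs at
    most [K * W], whereas iterating [loopfree_exec] would make the bound exponential in [n]. *)
Lemma while_exec e c : loopfree c -> exists2 K, 0 < K &
  forall (I : nat -> store -> Prop) W n, 0 < W ->
    (forall i s, I i s -> i <= n -> bounded W s /\ (eval s e != 0) = (i < n)) ->
    (forall i s, I i s -> i < n -> I i.+1 (sem c s)) ->
    forall s, I 0 s ->
    exists t s', [/\ exec (CWhile e c) s t s', t <= K * W * n.+1 & I n s'].
Proof.
move=> /loopfree_exec[K1 K10 H1]; have [K K0 He] := eval_cost e.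
exists (K + K1) => [|I W n W0 Ib Istep]; first by rewrite addn_gt0 K0.
(* Induction on the number [i] of iterations left; the extra unit in [i.+1] pays for the last,
   failing test. *)
suff H i s : I (n - i) s -> i <= n ->
    exists t s', [/\ exec (CWhile e c) s t s', t <= (K + K1) * W * i.+1 & I n s'].
  by move=> s I0; apply: H => //; rewrite subnn.
elim: i s => [|i IH] s Is le_in; have [bs test] := Ib _ _ Is (leq_subr _ _);
  have [_ cost_e] := He s W W0 bs.
  exists (ecost s e), s; split; [| nia | by rewrite subn0 in Is].
  by apply: ExecWhileFalse; apply/eqP; move: test; rewrite subn0 ltnn => /negbFE.
have lt_n : n - i.+1 < n by rewrite ltn_subrL (leq_ltn_trans _ le_in).
have [t1 [ex1 le1 _]] := H1 s W W0 bs.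
have := Istep _ _ Is lt_n; rewrite -subSn // subSS => /IH[|t2 [s' [ex2 le2 Is']]].
  exact: ltnW.
exists (ecost s e + t1 + t2), s'; split=> //; last nia.
by apply: ExecWhileTrue ex1 ex2; rewrite test.
Qed.

(** * The program *)

(* Arrays 0-4 are the input and the output; cells 0 and 1 of array 5 hold the
   partial cost as a fraction; array 6 holds the current project (cell 0), the
   number of projects satisfying agent [a] (cell [a + 1]) and a flag set once
   a solution has been written (cell 4). *)

Definition e_size := EGet 0 (EConst 1).
Definition e_proj := EGet 6 (EConst 0).
Definition e_flag := EGet 6 (EConst 4).
Definition e_index (a : nat) := EOp OpAdd (EOp OpMul (EConst a) e_size) e_proj.
Definition e_num (a : nat) := EGet 1 (e_index a).
Definition e_den (a : nat) := EGet 2 (e_index a).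
Definition e_costnum := EGet 5 (EConst 0).
Definition e_costden := EGet 5 (EConst 1).
Definition e_count (a : nat) := EGet 6 (EConst a.+1).

(** Cross-multiplied comparison: truncated subtraction leaves a nonzero value exactly when the first
    product is strictly larger. *)
Definition e_exceeds (a b : nat) :=
  EOp OpSub (EOp OpMul (e_num a) (e_den b)) (EOp OpMul (e_num b) (e_den a)).
Definition e_le (e1 e2 : expr) := EOp OpSub (EConst 1) (EOp OpSub e1 e2).

Definition c_count (b a : nat) :=
  CSet 6 (EConst a.+1)
    (EOp OpAdd (e_count a) (EOp OpSub (EConst 1) (e_exceeds a b))).

(** The order matters: the new cost numerator reads the old denominator, and the project index, read
    by all the other assignments, advances last. *)
Definition c_grant (b : nat) :=
  CSeq (CSet 3 e_proj (e_num b))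
 (CSeq (CSet 4 e_proj (e_den b))
 (CSeq (c_count b 0) (CSeq (c_count b 1) (CSeq (c_count b 2)
 (CSeq (CSet 5 (EConst 0) (EOp OpAdd (EOp OpMul e_costnum (e_den b))
                                     (EOp OpMul (e_num b) e_costden)))
 (CSeq (CSet 5 (EConst 1) (EOp OpMul e_costden (e_den b)))
       (CSet 6 (EConst 0) (EOp OpAdd e_proj (EConst 1))))))))).

Definition c_project (p q r : nat) :=
  CIf (e_exceeds q p) (c_grant p) (CIf (e_exceeds q r) (c_grant q) (c_grant r)).

Definition c_init :=
  CSeq (CSet 6 (EConst 0) (EConst 0))
 (CSeq (CSet 6 (EConst 1) (EConst 0))
 (CSeq (CSet 6 (EConst 2) (EConst 0))
 (CSeq (CSet 6 (EConst 3) (EConst 0))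
 (CSeq (CSet 5 (EConst 0) (EConst 0)) (CSet 5 (EConst 1) (EConst 1)))))).

Definition e_half (a : nat) :=
  e_le e_size (EOp OpMul (EConst 2) (e_count a)).

Definition c_check :=
  CSet 6 (EConst 4)
    (EOp OpMul (e_le e_costnum e_costden)
    (EOp OpMul (e_half 0) (EOp OpMul (e_half 1) (e_half 2)))).

Definition c_loop (p q r : nat) :=
  CWhile (EOp OpSub e_size e_proj) (c_project p q r).

(** The flag keeps later candidates from overwriting a solution already found. *)
Definition c_candidate (t : 'I_3 * 'I_3 * 'I_3) :=
  CIf e_flag CSkip
    (CSeq c_init (CSeq (c_loop t.1.1 t.1.2 t.2) c_check)).

(** * Symbolic execution and invariants of the program *)

Lemma sem_set a e1 e2 s k v : eval s e1 = k -> eval s e2 = v ->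
  sem (CSet a e1 e2) s = update s a k v.
Proof. by move=> <- <-. Qed.

Lemma sem_set_seq a e1 e2 c s k v r : eval s e1 = k -> eval s e2 = v ->
  sem c (update s a k v) = r -> sem (CSeq (CSet a e1 e2) c) s = r.
Proof. by move=> <- <-. Qed.

Lemma sub1_exceeds u v : 1 - (u - v) = (u <= v).
Proof. by case: leqP; lia. Qed.

Lemma c_grant_sem b s m i n d c0 c1 c2 u v :
    s 0 1 = m -> s 6 0 = i ->
    (forall a, s 1 (a * m + i) = n a) -> (forall a, s 2 (a * m + i) = d a) ->
    s 6 1 = c0 -> s 6 2 = c1 -> s 6 3 = c2 -> s 5 0 = u -> s 5 1 = v ->
  sem (c_grant b) s =
  update (update (update (update (update (update (update (update s
    3 i (n b)) 4 i (d b))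
    6 1 (c0 + (n 0 * d b <= n b * d 0)))
    6 2 (c1 + (n 1 * d b <= n b * d 1)))
    6 3 (c2 + (n 2 * d b <= n b * d 2)))
    5 0 (u * d b + n b * v)) 5 1 (v * d b)) 6 0 i.+1.
Proof.
move=> sm si sn sd s0 s1 s2 su sv; rewrite /c_grant -!sub1_exceeds.
apply: (@sem_set_seq _ _ _ _ _ i (n b)); [done | by rewrite /= sm si sn |].
apply: (@sem_set_seq _ _ _ _ _ i (d b)); [done | by rewrite /= /update /= sm si sd |].
apply: (@sem_set_seq _ _ _ _ _ 1 (c0 + (1 - (n 0 * d b - n b * d 0)))); [done |
  by rewrite /= /update /= sm si !sn !sd s0 |].
apply: (@sem_set_seq _ _ _ _ _ 2 (c1 + (1 - (n 1 * d b - n b * d 1)))); [done |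
  by rewrite /= /update /= sm si !sn !sd s1 |].
apply: (@sem_set_seq _ _ _ _ _ 3 (c2 + (1 - (n 2 * d b - n b * d 2)))); [done |
  by rewrite /= /update /= sm si !sn !sd s2 |].
apply: (@sem_set_seq _ _ _ _ _ 0 (u * d b + n b * v)); [done |
  by rewrite /= /update /= sm si !sn !sd su sv |].
apply: (@sem_set_seq _ _ _ _ _ 1 (v * d b)); [done |
  by rewrite /= /update /= sm si !sd sv |].
apply: (@sem_set _ _ _ _ 0 i.+1); first done.
by rewrite /= /update /= si addn1.
Qed.

Section Semantics.
Variables (m S : nat) (s0 : store).

Local Notation N a j := (s0 1 (a * m + j)).
Local Notation D a j := (s0 2 (a * m + j)).

(** Counterpart of [choice_agent] on the raw memory, so that the program can be analysed before
    rationals enter. *)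
Definition nat_choice (t : 'I_3 * 'I_3 * 'I_3) (j : nat) : 'I_3 :=
  let: (p, q, r) := t in
  if N q j * D p j <= N p j * D q j then
    if N q j * D r j <= N r j * D q j then r else q
  else p.

Definition x_num t j := N (nat_choice t j) j.
Definition x_den t j := D (nat_choice t j) j.

(** Running cost as a fraction that is never reduced. *)
Fixpoint cost_frac t (i : nat) : nat * nat :=
  if i is i'.+1 then
    let: (u, v) := cost_frac t i' in
    (u * x_den t i' + x_num t i' * v, v * x_den t i')
  else (0, 1).

Definition cover_count t a i : nat :=
  \sum_(0 <= j < i) (N a j * x_den t j <= x_num t j * D a j).

Definition cost_ok t : bool := (cost_frac t m).1 <= (cost_frac t m).2.
Definition cover_ok t a : bool := m <= 2 * cover_count t a m.
Definition nat_good t : bool :=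
  [&& cost_ok t, cover_ok t 0, cover_ok t 1 & cover_ok t 2].

Local Notation W := (S.+1 * m.+1).

(* The fraction in array 5 gains at most [S + 1] bits per project. *)
Definition store_bound (s : store) : Prop :=
  forall a k, s a k <= 2 ^ (if a == 5 then W else S).

Definition same_input (s : store) : Prop := forall a k, a < 3 -> s a k = s0 a k.

Definition written t i (s : store) : Prop :=
  forall j, j < i -> s 3 j = x_num t j /\ s 4 j = x_den t j.

Record loop_inv t i (s : store) : Prop := LoopInv {
  inv_input : same_input s;
  inv_bound : store_bound s;
  inv_written : written t i s;
  inv_proj : s 6 0 = i;
  inv_count0 : s 6 1 = cover_count t 0 i;
  inv_count1 : s 6 2 = cover_count t 1 i;
  inv_count2 : s 6 3 = cover_count t 2 i;
  inv_costnum : s 5 0 = (cost_frac t i).1;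
  inv_costden : s 5 1 = (cost_frac t i).2 }.

Hypothesis size_s0 : s0 0 1 = m.
Hypothesis m_le : m <= 2 ^ S.
Hypothesis s0_le : forall a k, s0 a k <= 2 ^ S.

Lemma cover_countS t a i :
  cover_count t a i.+1 =
  cover_count t a i + (N a i * x_den t i <= x_num t i * D a i).
Proof. by rewrite /cover_count big_nat_recr. Qed.

Lemma cover_count_le t a i : cover_count t a i <= i.
Proof.
elim: i => [|i IH]; first by rewrite /cover_count big_geq.
by rewrite cover_countS -(addn1 i) leq_add // leq_b1.
Qed.

(** Bounding numerator and denominator together closes the induction: [u * d + n * v + v * d] is at
    most [2 ^ S * (u + 2 * v)], hence at most [2 ^ S.+1 * (u + v)]. *)
Lemma cost_frac_le t i :
  (cost_frac t i).1 + (cost_frac t i).2 <= 2 ^ (S.+1 * i).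
Proof.
elim: i => [|i IH] /=; first by rewrite muln0.
case: (cost_frac t i) IH => u v /= IH.
have := s0_le 1 (nat_choice t i * m + i); rewrite -/(x_num t i).
have := s0_le 2 (nat_choice t i * m + i); rewrite -/(x_den t i).
by rewrite mulnS expnD expnS; nia.
Qed.

Lemma c_grant_inv t i s : loop_inv t i s -> i < m ->
  loop_inv t i.+1 (sem (c_grant (nat_choice t i)) s).
Proof.
case=> inp bd wr pj c0 c1 c2 cn cd lt_im.
have E a : s 1 (a * m + i) = N a i by rewrite inp.
have E' a : s 2 (a * m + i) = D a i by rewrite inp.
have Em : s 0 1 = m by rewrite inp.
rewrite (@c_grant_sem _ s m i (fun a => N a i) (fun a => D a i) _ _ _ _ _ Em pj
  E E' c0 c1 c2 cn cd).
cbv beta.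
have cost_le := cost_frac_le t i.+1.
have W_i : S.+1 * i.+1 <= W by rewrite leq_mul2l ltnS (ltnW lt_im) orbT.
have {cost_le W_i} cost_le : (cost_frac t i.+1).1 + (cost_frac t i.+1).2 <= 2 ^ W.
  by apply: leq_trans cost_le _; rewrite leq_exp2l.
(* Counters never exceed [m], so they fit in [S] bits like the input. *)
have m_le2 a : cover_count t a i.+1 <= 2 ^ S.
  by apply: leq_trans (cover_count_le _ _ _) (leq_trans lt_im m_le).
have {m_le2} := (m_le2 0, m_le2 1, m_le2 2).
rewrite !cover_countS /x_num /x_den => -[[le0 le1] le2].
have Ej := leq_trans lt_im m_le.
move: cost_le cn cd; rewrite /= [cost_frac t i]surjective_pairing /=.
set u := (cost_frac t i).1; set v := (cost_frac t i).2.
rewrite /x_num /x_den => cost_le cn cd.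
split=> //.
- by move=> [|[|[|//]]] k _; rewrite /update /= inp.
- move=> a k; have := bd a k; rewrite /update.
  move: a => [|[|[|[|[|[|[|a]]]]]]] //=; try by case: ifP.
    by case: ifP => _; [|case: ifP => _ //] => _; apply: leq_trans cost_le; lia.
  by do 4 (case: ifP => _ //).
- move=> j; rewrite ltnS leq_eqVlt /update /=; case: eqP => [-> _ //|_ /= lt_ji].
  exact: wr.
- by rewrite cover_countS /update /=.
- by rewrite cover_countS /update /=.
- by rewrite cover_countS /update /=.
- by rewrite /update /= [cost_frac t i]surjective_pairing.
by rewrite /update /= [cost_frac t i]surjective_pairing.
Qed.

Lemma c_project_inv t i s : loop_inv t i s -> i < m ->
  loop_inv t i.+1 (sem (c_project t.1.1 t.1.2 t.2) s).
Proof.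
move=> inv lt_im.
suff -> : sem (c_project t.1.1 t.1.2 t.2) s = sem (c_grant (nat_choice t i)) s.
  exact: c_grant_inv.
have exceedsE a b : eval s (e_exceeds a b) = N a i * D b i - N b i * D a i.
  by rewrite /= (inv_proj inv) !(inv_input inv) // size_s0.
case: t inv => [[p q] r] inv.
transitivity (if eval s (e_exceeds q p) != 0 then sem (c_grant p) s
  else if eval s (e_exceeds q r) != 0 then sem (c_grant q) s
  else sem (c_grant r) s); first by [].
rewrite !exceedsE /nat_choice !subn_eq0.
by rewrite !if_neg; case: (_ <= _) => //; case: (_ <= _).
Qed.

(** Invariant between candidates: scratch cells are reset by [c_init], so only the input, the sizes
    and the meaning of a raised flag persist. *)
Definition run_inv (s : store) : Prop :=
  [/\ same_input s, store_bound s
    & s 6 4 != 0 -> exists2 t, nat_good t & written t m s].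

Lemma store_bounded s : store_bound s -> bounded W s.
Proof.
move=> bd a k; apply: leq_trans (bd a k) _.
rewrite leq_exp2l //; case: ifP => _ //.
exact: leq_trans (leqnSn S) (leq_pmulr _ _).
Qed.

Lemma c_init_inv t s : run_inv s -> loop_inv t 0 (sem c_init s).
Proof.
case=> inp bd _; split=> //.
- by move=> [|[|[|//]]] k _; rewrite /= /update /= inp.
- move=> a k; have := bd a k; rewrite /= /update /=.
  move: a => [|[|[|[|[|[|[|a]]]]]]] //=.
    by case: ifP => _; [rewrite expn_gt0 | case: ifP].
  by do 4 (case: ifP => _ //).
- by rewrite /cover_count big_geq.
- by rewrite /cover_count big_geq.
by rewrite /cover_count big_geq.
Qed.

Lemma c_check_inv t s : loop_inv t m s ->
  run_inv (sem c_check s) /\ (nat_good t -> sem c_check s 6 4 != 0).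
Proof.
move=> inv.
(* The product of the 0/1 tests is their conjunction. *)
have -> : sem c_check s = update s 6 4 (nat_good t).
  apply: sem_set => //=.
  rewrite (inv_costnum inv) (inv_costden inv) (inv_input inv) // size_s0.
  rewrite (inv_count0 inv) (inv_count1 inv) (inv_count2 inv) !sub1_exceeds.
  by rewrite !mulnb.
split; last by rewrite /update /= => ->.
split; last 1 first.
- rewrite /update /= eqb0 negbK => gd; exists t => // j lt_jm.
  exact: inv_written inv _ lt_jm.
- by move=> [|[|[|//]]] k _; rewrite /update /= (inv_input inv).
move=> a k; rewrite /update; case: ifP => [/andP[/eqP-> _]|_].
  by rewrite /= (leq_trans (leq_b1 _)) // expn_gt0.
exact: inv_bound inv a k.
Qed.

End Semantics.

(** * Running time of the search over candidates *)

Definition legal_input (m S : nat) (s0 : store) : Prop :=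
  [/\ s0 0 1 = m, m <= 2 ^ S & forall a k, s0 a k <= 2 ^ S].

Lemma c_candidate_exec t : exists2 K, 0 < K &
  forall m S s0 s, legal_input m S s0 -> run_inv m S s0 s ->
  exists u s', [/\ exec (c_candidate t) s u s', u <= K * (S.+1 * m.+1) * m.+1,
    run_inv m S s0 s', nat_good m s0 t -> s' 6 4 != 0
  & s 6 4 != 0 -> s' 6 4 != 0].
Proof.
have [K0 K00 H0] := eval_cost e_flag.
have [K1 K10 H1] := @loopfree_exec c_init isT.
have [K2 K20 H2] := @while_exec (EOp OpSub e_size e_proj)
  (c_project t.1.1 t.1.2 t.2) isT.
have [K3 K30 H3] := @loopfree_exec c_check isT.
exists (K0 + K1 + K2 + K3 + 1) => [|m S s0 s [size_s0 m_le s0_le] inv].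
  by rewrite addn1.
set W := S.+1 * m.+1.
have W0 : 0 < W by [].
have leW K : K * W <= K * W * m.+1 by rewrite leq_pmulr.
have [inp bd fin] := inv.
have [_ cost0] := H0 s W W0 (store_bounded bd).
(* With the flag raised, the candidate is skipped and the recorded solution survives. *)
have [flag0|flag] := eqVneq (s 6 4) 0; last first.
  exists (ecost s e_flag + 1), s; split=> //.
    by apply: ExecIfTrue => //; constructor.
  by have := leW K0; nia.
have inv0 := c_init_inv t inv.
have [t1 [ex1 le1 _]] := H1 s W W0 (store_bounded bd).
have [||t2 [s2 [ex2 le2 inv2]]] := H2 (loop_inv m S s0 t) W m W0 _ _ _ inv0.
- move=> i s' inv' le_im; split; first exact: store_bounded (inv_bound inv').
  by rewrite /= (inv_proj inv') (inv_input inv') // size_s0 subn_eq0 -ltnNge.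
- by move=> i s' inv' lt_im; apply: c_project_inv.
have [t3 [ex3 le3 _]] := H3 s2 W W0 (store_bounded (inv_bound inv2)).
have [inv3 good3] := c_check_inv size_s0 inv2.
exists (ecost s e_flag + (t1 + (t2 + t3))), (sem c_check s2); split=> //.
  by apply: ExecIfFalse => //; apply: ExecSeq ex1 (ExecSeq ex2 ex3).
by have := leW K0; have := leW K1; have := leW K3; nia.
Qed.

(** Since [run_inv] restores the same size bound after each candidate, the constants add up instead
    of multiplying. *)
Lemma candidates_exec (ts : seq ('I_3 * 'I_3 * 'I_3)) : exists2 K, 0 < K &
  forall m S s0 s, legal_input m S s0 -> run_inv m S s0 s ->
  exists u s', [/\ exec (foldr (fun t => CSeq (c_candidate t)) CSkip ts) s u s',
    u <= K * (S.+1 * m.+1) * m.+1, run_inv m S s0 s',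
    has (nat_good m s0) ts -> s' 6 4 != 0
  & s 6 4 != 0 -> s' 6 4 != 0].
Proof.
elim: ts => [|t ts [K K0 IH]] /=.
  exists 1 => // m S s0 s _ inv; exists 1, s; split=> //; constructor.
have [K1 K10 H] := c_candidate_exec t.
exists (K1 + K) => [|m S s0 s legal inv]; first by rewrite addn_gt0 K10.
have [u1 [s1 [ex1 le1 inv1 gd1 flag1]]] := H m S s0 s legal inv.
have [u2 [s2 [ex2 le2 inv2 gd2 flag2]]] := IH m S s0 s1 legal inv1.
exists (u1 + u2), s2; split=> //.
- exact: ExecSeq ex1 ex2.
- by rewrite !mulnDl leq_add.
- by case/orP => [/gd1/flag2|/gd2].
by move=> /flag1/flag2.
Qed.

Local Open Scope ring_scope.

(** * Majority comparisons between agents *)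

Section Candidates.
Variables (F : realFieldType) (m : nat) (d : 'M[F]_(3, m)).

(** Returning an agent rather than a value shows that each coordinate is an existing demand, which
    the program merely copies. *)
Definition choice_agent (p q r : 'I_3) (j : 'I_m) : 'I_3 :=
  if d q j <= d p j then if d q j <= d r j then r else q else p.

(* [candidate i i i] is the demand vector of agent [i] itself. *)
Definition candidate (p q r : 'I_3) : 'rV[F]_m :=
  \row_j d (choice_agent p q r j) j.

Definition majority (l i : 'I_3) : bool :=
  (m <= 2 * #|[set j | (d l j <= d i j)%R]|)%N.

(** The two comparison sets cover all projects, so one of them contains at least half. *)
Lemma majority_total l i : majority l i || majority i l.
Proof.
rewrite /majority.
have : (m <= #|[set j | (d l j <= d i j)%R]| + #|[set j | (d i j <= d l j)%R]|)%N.
  rewrite -{1}[m]card_ord -cardsT; apply: leq_trans (leq_card_setU _ _).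
  by apply/subset_leq_card/subsetP => j _; rewrite !inE le_total.
by move=> le_m; apply/orP; lia.
Qed.

Lemma majority_satisfied l (x : 'rV[F]_m) i i' :
  majority i i' -> (forall j, d i j <= d i' j -> d l j <= x 0 j) ->
  satisfied (m%:R / 2) d x l.
Proof.
move=> maj le_x; rewrite /satisfied ler_pdivrMr ?ltr0n // -natrM ler_nat mulnC.
apply: (leq_trans maj); rewrite leq_mul2l /=.
by apply/subset_leq_card/subsetP => j; rewrite !inE => /le_x.
Qed.

Lemma candidate_satisfied p q r i :
  majority q p -> majority p r -> i \in [:: p; q; r] ->
  satisfied (m%:R / 2) d (candidate p q r) i.
Proof.
move=> majqp majpr; rewrite !inE.
case/or3P => /eqP->; [apply: (majority_satisfied majpr)
  | apply: (majority_satisfied majqp) | apply: (majority_satisfied majqp)];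
  move=> j le_j; rewrite mxE /choice_agent.
(* Here [r] is at least [p]; if [q] is chosen over [r], its demand is larger still. *)
- by case: (leP (d q j) (d p j)) => // _; case: (leP (d q j) (d r j)) => // ?; lra.
- by rewrite le_j; case: (leP (d q j) (d r j)).
by rewrite le_j; case: (leP (d q j) (d r j)) => // /ltW.
Qed.

(** Up to rotation, distinct demands for a project satisfy [p > q > r], where the candidates take
    [q], [p], [r], or [p > r > q], where they take [r], [q], [r] and the median replaces the
    maximum. The case analysis also covers ties. *)
Lemma candidate_cycle_sum p q r :
  \sum_j candidate p q r 0 j + \sum_j candidate q r p 0 j
    + \sum_j candidate r p q 0 j
  <= \sum_j d p j + \sum_j d q j + \sum_j d r j.
Proof.
rewrite -!big_split /=; apply: ler_sum => j _; rewrite !mxE /choice_agent.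
by case: (leP (d q j) (d p j)); case: (leP (d r j) (d q j));
  case: (leP (d p j) (d r j)); case: (leP (d q j) (d r j));
  case: (leP (d r j) (d p j)); case: (leP (d p j) (d q j)); lra.
Qed.

Hypothesis inst : is_instance d.

Definition good (x : 'rV[F]_m) : Prop :=
  budget_feasible x /\ forall i, satisfied (m%:R / 2) d x i.

Lemma candidate_solution p q r : is_solution (candidate p q r).
Proof. by move=> j; rewrite mxE; apply: inst.1. Qed.

Lemma dominant_agent i :
  (forall l, majority l i) -> good (candidate i i i).
Proof.
have cand_i j : candidate i i i 0 j = d i j.
  by rewrite mxE /choice_agent !lexx.
move=> maj; split.
  by rewrite /budget_feasible (eq_bigr _ (fun j _ => cand_i j)); apply: inst.2.
by move=> l; apply: (majority_satisfied (maj l)) => j; rewrite cand_i.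
Qed.

Lemma majority_cycle p q r :
  (forall i, i \in [:: p; q; r]) ->
  majority q p -> majority r q -> majority p r ->
  [\/ good (candidate p q r), good (candidate q r p)
    | good (candidate r p q)].
Proof.
move=> all_pqr qp rq pr.
have sat : [/\ forall i, satisfied (m%:R / 2) d (candidate p q r) i,
    forall i, satisfied (m%:R / 2) d (candidate q r p) i
  & forall i, satisfied (m%:R / 2) d (candidate r p q) i].
  by split=> i; apply: candidate_satisfied => //;
    have:= all_pqr i; rewrite !inE => /or3P[] ->; rewrite ?orbT.
case: sat => satp satq satr.
have := candidate_cycle_sum p q r.
have := inst.2 p; have := inst.2 q; have := inst.2 r.
move=> sr sq sp ssum.
(* The three costs sum to at most 3, so they cannot all exceed 1. *)
have [le1|gt1] := leP (\sum_j candidate p q r 0 j) 1; first by constructor 1.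
have [le1'|gt1'] := leP (\sum_j candidate q r p 0 j) 1; first by constructor 2.
constructor 3; split=> //; rewrite /budget_feasible; lra.
Qed.

Lemma good_candidate_exists : exists t : 'I_3 * 'I_3 * 'I_3,
  good (candidate t.1.1 t.1.2 t.2).
Proof.
pose a : 'I_3 := inord 0; pose b : 'I_3 := inord 1; pose c : 'I_3 := inord 2.
have all_abc i : i \in [:: a; b; c].
  by rewrite !inE -!val_eqE /= !inordK //; case: i => [[|[|[]]]].
have all_acb i : i \in [:: a; c; b].
  by have := all_abc i; rewrite !inE orbA orbAC -orbA.
have refl i : majority i i.
  by have := majority_total i i; rewrite orbb.
have win i l l' : (forall k, k \in [:: i; l; l']) ->
    majority l i -> majority l' i -> good (candidate i i i).
  move=> all_k li l'i; apply: dominant_agent => k; have := all_k k.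
  by rewrite !inE => /or3P[] /eqP->.
(* Of the eight orientations of the three pairs, two are cycles; in the other six some agent beats
   both others. *)
have [ab|ba] := orP (majority_total a b); have [bc|cb] := orP (majority_total b c);
  have [ac|ca] := orP (majority_total a c).
- exists (c, c, c); apply: (win c a b) => // i.
  by have := all_abc i; rewrite !inE => /or3P[] ->; rewrite ?orbT.
- have [] := majority_cycle all_acb ca bc ab => gd.
  + by exists (a, c, b).
  + by exists (c, b, a).
  + by exists (b, a, c).
- exists (b, b, b); apply: (win b a c) => // i.
  by have := all_abc i; rewrite !inE => /or3P[] ->; rewrite ?orbT.
- exists (b, b, b); apply: (win b a c) => // i.
  by have := all_abc i; rewrite !inE => /or3P[] ->; rewrite ?orbT.
- exists (c, c, c); apply: (win c a b) => // i.
  by have := all_abc i; rewrite !inE => /or3P[] ->; rewrite ?orbT.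
- by exists (a, a, a); apply: (win a b c).
- have [] := majority_cycle all_abc ba cb ac => gd.
  + by exists (a, b, c).
  + by exists (b, c, a).
  + by exists (c, a, b).
by exists (a, a, a); apply: (win a b c).
Qed.

End Candidates.

(** * Rational instances in memory *)

Lemma nth_allpairs_enum (m : nat) (I : Type) (F : I -> 'I_m -> nat) (i0 : I) s a
    (j : 'I_m) : (a < size s)%N ->
  nth 0%N [seq F i j | i <- s, j <- enum 'I_m] (a * m + j) = F (nth i0 s a) j.
Proof.
elim: s a => [//|i s IH] [|a] /= lt_a.
  rewrite mul0n add0n nth_cat size_map size_enum_ord ltn_ord.
  by rewrite (nth_map j) ?size_enum_ord // nth_ord_enum.
rewrite nth_cat size_map size_enum_ord mulSn -addnA ltnNge leq_addr /=.
by rewrite addKn IH.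
Qed.

Lemma sum_bitlen_ge (l : seq nat) : (size l <= \sum_(v <- l) bitlen v)%N.
Proof. by elim: l => [|v l IH]; rewrite ?big_nil // big_cons /= -add1n leq_add. Qed.

(** A number is below 2 to its bit length, which is one term of the sum; positions past the end read
    0. *)
Lemma le_bitlen_sum (l : seq nat) k :
  (nth 0%N l k <= 2 ^ (\sum_(v <- l) bitlen v))%N.
Proof.
have [lt_k|ge_k] := ltnP k (size l); last by rewrite nth_default.
rewrite (big_rem (nth 0%N l k)) ?mem_nth //=.
apply: leq_trans (ltnW (trunc_log_ltn _ (ltnSn 1))) _.
by rewrite leq_exp2l // leq_addr.
Qed.

Section RationalInstance.
Variables (m : nat) (d : 'M[rat]_(3, m)).

Lemma load_legal : legal_input m (input_size d) (load d).
Proof.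
have le_load a k : (load d a k <= 2 ^ input_size d)%N.
  rewrite /load; have [lt_a|ge_a] := ltnP a (size (input d)); last first.
    by rewrite [nth [::] _ _]nth_default // nth_nil.
  apply: leq_trans (le_bitlen_sum _ _) _.
  rewrite leq_exp2l // /input_size.
  by rewrite [leqRHS](big_rem (nth [::] (input d) a)) ?mem_nth //= leq_addr.
by split=> //; apply: le_load 0%N 1%N.
Qed.

(** The [3 * m] numerators take at least one bit each. This turns bounds in [m] into bounds in the
    input size. *)
Lemma size_le_input_size : (m <= input_size d)%N.
Proof.
rewrite /input_size /input !big_cons big_nil addn0.
have := sum_bitlen_ge [seq `|denq (d i j)|%N | i <- enum 'I_3, j <- enum 'I_m].
rewrite size_allpairs !size_enum_ord; lia.
Qed.

Let s0 := load d.
Local Notation N a j := (s0 1%N (a * m + j)%N).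
Local Notation D a j := (s0 2%N (a * m + j)%N).

Lemma load_num (a : 'I_3) (j : 'I_m) : N a j = `|numq (d a j)|%N.
Proof.
rewrite /s0 /load /= (nth_allpairs_enum _ a) ?size_enum_ord //.
by rewrite nth_ord_enum.
Qed.

Lemma load_den (a : 'I_3) (j : 'I_m) : D a j = `|denq (d a j)|%N.
Proof.
rewrite /s0 /load /= (nth_allpairs_enum _ a) ?size_enum_ord //.
by rewrite nth_ord_enum.
Qed.

Lemma load_den_gt0 (a : 'I_3) (j : 'I_m) : (0 < D a j)%N.
Proof. by rewrite load_den absz_gt0 denq_neq0. Qed.

Hypothesis inst : is_instance d.

Lemma load_frac (a : 'I_3) (j : 'I_m) : d a j = (N a j)%:R / (D a j)%:R.
Proof.
have /andP[d_ge0 _] := inst.1 a j.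
rewrite load_num load_den -{1}[d a j]divq_num_den !pmulrn.
by rewrite !gez0_abs // numq_ge0.
Qed.

Lemma frac_le (u v u' v' : nat) : (0 < v)%N -> (0 < v')%N ->
  (u%:R / v%:R <= u'%:R / v'%:R :> rat) = (u * v' <= u' * v)%N.
Proof.
move=> v0 v'0; rewrite ler_pdivrMr ?ltr0n // mulrAC ler_pdivlMr ?ltr0n //.
by rewrite -!natrM ler_nat.
Qed.

Lemma load_le (a b : 'I_3) (j : 'I_m) :
  (d a j <= d b j) = (N a j * D b j <= N b j * D a j)%N.
Proof. by rewrite !load_frac frac_le ?load_den_gt0. Qed.

Variable t : 'I_3 * 'I_3 * 'I_3.
Let x : 'rV[rat]_m := candidate d t.1.1 t.1.2 t.2.

Lemma nat_choiceE (j : 'I_m) :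
  nat_choice m s0 t j = choice_agent d t.1.1 t.1.2 t.2 j.
Proof. by rewrite /choice_agent /nat_choice !load_le; case: t => [[p q] r]. Qed.

Lemma x_frac (j : 'I_m) : x 0 j = (x_num m s0 t j)%:R / (x_den m s0 t j)%:R.
Proof. by rewrite mxE load_frac /x_num /x_den nat_choiceE. Qed.

Lemma x_den_gt0 (j : 'I_m) : (0 < x_den m s0 t j)%N.
Proof. exact: load_den_gt0. Qed.

Lemma cover_countE (a : 'I_3) :
  cover_count m s0 t a m = #|[set j | d a j <= x 0 j]|.
Proof.
rewrite /cover_count big_mkord -sum1dep_card [RHS]big_mkcond /=.
by apply: eq_bigr => j _; rewrite x_frac load_frac frac_le ?x_den_gt0 ?load_den_gt0.
Qed.

(** Positivity of the denominator is carried along because adding fractions divides by it. *)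
Lemma cost_fracE i : (i <= m)%N ->
  let: (u, v) := cost_frac m s0 t i in (0 < v)%N /\
  u%:R / v%:R
    = \sum_(0 <= j < i) (x_num m s0 t j)%:R / (x_den m s0 t j)%:R :> rat.
Proof.
elim: i => [_|i IH lt_im] /=; first by rewrite big_geq // mul0r.
have := IH (ltnW lt_im); case: (cost_frac m s0 t i) => u v [v0 uv].
have den0 := x_den_gt0 (Ordinal lt_im); rewrite /= in den0.
split; first by rewrite muln_gt0 v0.
rewrite big_nat_recr //= -uv natrD !natrM.
by field; rewrite !pnatr_eq0 -!lt0n v0 den0.
Qed.

Lemma nat_goodP : reflect (good d x) (nat_good m s0 t).
Proof.
have cost : cost_ok m s0 t = (\sum_j x 0 j <= 1).
  rewrite /cost_ok; have := cost_fracE (leqnn m).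
  case: (cost_frac m s0 t m) => u v [v0]; rewrite big_mkord.
  rewrite -(eq_bigr _ (fun j _ => x_frac j)) => <-.
  by rewrite /= ler_pdivrMr ?ltr0n // mul1r ler_nat.
have cover (a : 'I_3) : cover_ok m s0 t a <-> satisfied (m%:R / 2) d x a.
  rewrite /cover_ok /satisfied cover_countE.
  by rewrite ler_pdivrMr ?ltr0n // -natrM ler_nat mulnC.
apply: (iffP and4P); rewrite /good /budget_feasible -cost.
  case=> ok c0 c1 c2; split=> // a; apply/cover.
  by case: a => [[|[|[|//]]]].
case=> ok sat; split=> //.
- exact/(cover ord0)/sat.
- exact/(cover (@Ordinal 3 1 isT))/sat.
exact/(cover ord_max)/sat.
Qed.

End RationalInstance.

Theorem theorem3 (R : realType) :
  (forall (m : nat) (d : 'M[R]_(3, m)),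
     (3 <= m)%N -> is_instance d ->
     exists x : 'rV[R]_m,
       [/\ is_solution x, budget_feasible x
         & forall i : 'I_3, satisfied (m%:R / 2) d x i]) /\
  poly_time_computable
    (fun (m : nat) (d : 'M[rat]_(3, m)) => (3 <= m)%N /\ is_instance d)
    (fun (m : nat) (d : 'M[rat]_(3, m)) (x : 'rV[rat]_m) =>
       [/\ is_solution x, budget_feasible x
         & forall i : 'I_3, satisfied (m%:R / 2) d x i]).
Proof.
split=> [m d _ inst|].
  have [[[p q] r] [cost sat]] := good_candidate_exists inst.
  by exists (candidate d p q r); split=> //; apply: candidate_solution.
have [K K0 exec_all] := candidates_exec (enum {: 'I_3 * 'I_3 * 'I_3}).
exists (foldr (fun t => CSeq (c_candidate t)) CSkip (enum {: 'I_3 * 'I_3 * 'I_3})).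
(* The cost is at most [K * S.+1 ^ 3] with [S] the input size. For positive [S] this is at most
   [8 * K * S ^ 3]; the additive constant covers [S = 0]. *)
exists (8 * K)%N, 3 => m d [_ inst].
have legal := load_legal d.
have inv0 : run_inv m (input_size d) (load d) (load d).
  (* Array 6 starts at 0, so the clause about the flag is vacuous. *)
  have [_ _ le_load] := legal; split=> //.
    move=> a k; apply: leq_trans (le_load a k) _; rewrite leq_exp2l //.
    by case: ifP => _ //; nia.
have [u [s [ex_s le_u [_ _ fin] found _]]] := exec_all _ _ _ _ legal inv0.
have [|t gd wr] := fin.
  (* The existence result guarantees that the search succeeds; the triple actually recorded may be a
     different one. *)
  apply: found; apply/hasP; have [t gd] := good_candidate_exists inst.
  by exists t; [rewrite mem_enum | apply/nat_goodP].
have [cost sat] := nat_goodP inst t gd.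
exists u, s, (candidate d t.1.1 t.1.2 t.2); split=> //.
- apply: leq_trans le_u _; have := size_le_input_size d.
  move: (input_size d) => S le_mS.
  apply: (@leq_trans (K * S.+1 ^ 3)%N).
    by rewrite -!mulnA !expnS expn0 muln1 !leq_mul // ltnS.
  rewrite [(8 * K)%N]mulnC -mulnA -mulnDr leq_mul2l; apply/orP; right.
  case: S {le_mS} => // S; apply: leq_trans (leq_addr _ _).
  by rewrite -[8%N]/(2 ^ 3)%N -expnMn leq_exp2r; lia.
- move=> j; have [-> ->] := wr j (ltn_ord j).
  by rewrite -lt0n x_den_gt0 // (x_frac inst).
by split=> //; apply: candidate_solution.
Qed.
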